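(* Let $d,n\geq1$ be integers. The set $\mathrm{STab}_d(n)$ of standard $d$-tableaux of size $n$ is in bijection with the set ${\rm Cont}_d(n)$ of content arrays.
   Context: Let $q$ be an indeterminate. A $d$-partition of $n$ is a $d$-tuple $\boldsymbol{\lambda}=(\boldsymbol{\lambda}^{(1)},\dots,\boldsymbol{\lambda}^{(d)})$ of (possibly empty) partitions of total size $n$. A $d$-node of $\boldsymbol{\lambda}$ is a triple $(x,y,k)$ where $(x,y)$ (row $x$, column $y$) is a node of the Young diagram of $\boldsymbol{\lambda}^{(k)}$. A $d$-tableau of shape $\boldsymbol{\lambda}$ is a bijection between $\{1,\dots,n\}$ and the set of $d$-nodes of $\boldsymbol{\lambda}$; it is standard if its entries increase along every row and down every column of each diagram. $\mathrm{STab}_d(n)$ is the set of all standard $d$-tableaux of size $n$ (of any shape that is a $d$-partition of $n$). ${\rm Cont}_d(n)$ is the set of $2\times n$ arrays $\begin{pmatrix}\mathsf{a}_1,\dots,\mathsf{a}_n\\ \mathsf{c}_1,\dots,\mathsf{c}_n\end{pmatrix}$ with entries in $\mathbb{C}(q)$ such that: (1) $\mathsf{c}_1=1$ and $\mathsf{a}_i^d=1$ for all $i=1,\dots,n$; (2) if $\mathsf{c}_j\neq1$ for some $j>1$, then there exists $i<j$ with $\mathsf{a}_i=\mathsf{a}_j$ and $\mathsf{c}_i\in\{\mathsf{c}_jq^{-2},\mathsf{c}_jq^2\}$; (3) if $\mathsf{a}_j=\mathsf{a}_k$ and $\mathsf{c}_j=\mathsf{c}_k$ for $j<k$, then $k-j\geq3$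 and there exist $j+1\leq i_1,i_2\leq k-1$ with $\mathsf{a}_{i_1}=\mathsf{a}_{i_2}=\mathsf{a}_j$, $\mathsf{c}_{i_1}=\mathsf{c}_jq^{-2}$ and $\mathsf{c}_{i_2}=\mathsf{c}_jq^2$. *)

(* Defs.v *)
From HB Require Import structures.
From mathcomp Require Import all_boot all_order all_algebra.
From mathcomp Require Import complex.
From mathcomp Require Import classical_sets functions cardinality reals.

Set Implicit Arguments.
Unset Strict Implicit.
Unset Printing Implicit Defensive.

Import GRing.Theory.

Local Open Scope classical_set_scope.

(** Partitions are finite nonincreasing sequences of positive integers. *)
Definition is_partition (s : seq nat) : bool :=
  sorted geq s && (0 \notin s).

Definition is_dpartition (d n : nat) (la : {ffun 'I_d -> seq nat}) : bool :=
  [forall k : 'I_d, is_partition (la k)] && (\sum_(k < d) sumn (la k) == n).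

(** Triples (row, column, component), all counted from 0. *)
Definition node (d : nat) : Type := (nat * nat * 'I_d)%type.

Definition node_row (d : nat) (u : node d) : nat := u.1.1.
Definition node_col (d : nat) (u : node d) : nat := u.1.2.
Definition node_comp (d : nat) (u : node d) : 'I_d := u.2.

Definition dnodes (d : nat) (la : {ffun 'I_d -> seq nat}) : set (node d) :=
  [set u | (node_row u < size (la (node_comp u)))%N /\
           (node_col u < nth 0 (la (node_comp u)) (node_row u))%N].

(** [t i] is the node filled with the entry [i]; the entries are 0, ..., n - 1
    instead of 1, ..., n. *)
Definition is_dtableau (d n : nat) (la : {ffun 'I_d -> seq nat})
    (t : {ffun 'I_n -> node d}) : Prop :=
  set_bij [set: 'I_n] (dnodes la) t.

Definition is_standard (d n : nat) (t : {ffun 'I_n -> node d}) : Prop :=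
  (forall i j : 'I_n,
     node_comp (t i) = node_comp (t j) -> node_row (t i) = node_row (t j) ->
     (node_col (t i) < node_col (t j))%N -> (i < j)%N) /\
  (forall i j : 'I_n,
     node_comp (t i) = node_comp (t j) -> node_col (t i) = node_col (t j) ->
     (node_row (t i) < node_row (t j))%N -> (i < j)%N).

(** Standard [d]-tableaux of size [n], each paired with its shape. *)
Definition STab (d n : nat) :
    set ({ffun 'I_d -> seq nat} * {ffun 'I_n -> node d}) :=
  [set T | [/\ is_dpartition n T.1, is_dtableau T.1 T.2 & is_standard T.2]].

Arguments STab d n : clear implicits.

Local Open Scope ring_scope.

(** The field C(q), where C = R[i] for the real numbers R. *)
Definition Cq (R : realType) : fieldType := {fraction {poly R[i]}}.

Definition q_indet (R : realType) : Cq R := tofrac ('X : {poly R[i]}).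

(** Row 0 of [M] is (a_1, ..., a_n) and row 1 is (c_1, ..., c_n); columns are
    counted from 0, so that column 0 is the first one. *)
Definition Cont (R : realType) (d n : nat) : set 'M[Cq R]_(2, n) :=
  [set M | let a := M 0 in let c := M 1 in let q := q_indet R in
    [/\ (forall i : 'I_n, i = 0%N :> nat -> c i = 1) /\
        (forall i : 'I_n, a i ^+ d = 1),
        forall j : 'I_n, (0 < j)%N -> c j <> 1 ->
          exists i : 'I_n, [/\ (i < j)%N, a i = a j &
            c i = c j * q ^- 2 \/ c i = c j * q ^+ 2]
      & forall j k : 'I_n, (j < k)%N -> a j = a k -> c j = c k ->
          (3 <= k - j)%N /\
          exists i1 i2 : 'I_n,
            [/\ (j < i1 < k)%N, (j < i2 < k)%N,
                a i1 = a j /\ a i2 = a j,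
                c i1 = c j * q ^- 2 & c i2 = c j * q ^+ 2]]].

Arguments Cont R d n : clear implicits.

(* Main.v *)
Require Import Defs.
From mathcomp Require Import all_boot all_order all_algebra.
From mathcomp Require Import separable cyclotomic complex fraction zify.
From mathcomp Require Import classical_sets functions reals.

Set Implicit Arguments.
Unset Strict Implicit.
Unset Printing Implicit Defensive.

Import Order.TTheory GRing.Theory Num.Theory.

(** The bijection sends a standard tableau to its sequence of contents: the
    entry in row x and column y of component k gives the column (z_k, q^(2(y-x)))
    of the array, where z_1, ..., z_d are the d-th roots of unity of C(q)
    ([roots_of_unity_Cq]). As the z_k are distinct and q is not a root of unity,
    an array whose entries have this form is the same thing as a word in the
    letters (k, m), with k a component and m an integer, and the three axioms of
    content arrays become the two axioms of [is_content_word] ([array_Cont]).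
    The axioms force every array to have this form ([Cont_array]), so that only
    the words remain to be compared with the tableaux.

    A standard tableau is determined by the order in which its nodes are
    inserted, because the shape is the set of these nodes ([dnodes_inj]). The
    sequences of nodes that occur are those without repetition in which each
    node comes after its upper and its left neighbour ([is_growth],
    [tableau_growth], [shape_STab]).

    The contents of a growth form a content word: two nodes on one diagonal are
    separated, in the order of insertion, by nodes on both adjacent diagonals
    ([growth_content_word]). The word determines the growth, because each
    diagonal is filled without gaps from the boundary inwards
    ([growth_letter_inj]). Conversely, this says where the nodes have to
    go: the letter (k, m) at index j goes to the diagonal m of component k, at the
    position given by the number of earlier occurrences of the same letter
    ([growth_of]). The axioms of content words say that occurrences of adjacent
    letters interleave, and that the letter closer to zero comes first
    ([earlier_neighbour]); this puts the upper and left neighbours in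
    place in time ([growth_of_growth]). *)

(** * Growth sequences of nodes *)

(** Standard tableaux without their shapes. Asking only for the two adjacent
    nodes makes the condition local, as the axioms of content arrays are. *)
Definition is_growth (d n : nat) (t : 'I_n -> node d) : Prop :=
  [/\ injective t,
      forall j x y k, t j = (x.+1, y, k) ->
        exists2 i : 'I_n, (i < j)%N & t i = (x, y, k)
    & forall j x y k, t j = (x, y.+1, k) ->
        exists2 i : 'I_n, (i < j)%N & t i = (x, y, k)].

(** Descent on the distance to (x, y): a step up or left from (x', y') lowers the
    index. *)
Lemma growth_northwest (d n : nat) (t : 'I_n -> node d) (j : 'I_n) x y x' y' k :
    is_growth t -> t j = (x', y', k) -> (x <= x')%N -> (y <= y')%N ->
  exists2 i : 'I_n, (i <= j)%N & t i = (x, y, k).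
Proof.
case=> _ tU tL; have [m] := ubnP (x' + y')%N.
elim: m => // m IHm in j x' y' *; rewrite ltnS => le_m tj lex ley.
case: (ltnP x x') => [ltx|gex].
  case: x' => // x' in le_m tj lex ltx *.
  have [i lt_ij ti] := tU _ _ _ _ tj.
  have [|//|//|i' le_i'i ti'] := IHm i x' y' _ ti; first by lia.
  by exists i' => //; apply: leq_trans le_i'i (ltnW lt_ij).
case: (ltnP y y') => [lty|gey]; last first.
  by exists j => //; rewrite tj; congr (_, _, _); lia.
case: y' => // y' in le_m tj ley lty *.
have [i lt_ij ti] := tL _ _ _ _ tj.
have [|//|//|i' le_i'i ti'] := IHm i x' y' _ ti; first by lia.
by exists i' => //; apply: leq_trans le_i'i (ltnW lt_ij).
Qed.

(** A node further left in the same row, or further up in the same column, is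
    reached by [growth_northwest] with an index that injectivity identifies. *)
Lemma growth_standard (d n : nat) (t : {ffun 'I_n -> node d}) :
  is_growth t -> is_standard t.
Proof.
move=> gt; have [inj_t _ _] := gt.
split=> i j; case ti: (t i) => [[x y] k]; case tj: (t j) => [[x' y'] k'];
  rewrite /node_comp /node_row /node_col /= => ek eq_xy lt_xy; subst k' .
  subst x'; have [|i' le_i' ti'] := growth_northwest gt tj (leqnn x) (y := y).
    exact: ltnW.
  have eq_i : i' = i by apply: inj_t; rewrite ti' ti.
  rewrite ltn_neqAle -eq_i le_i' andbT; apply/eqP => /val_inj eij.
  by move: ti'; rewrite eij tj => -[e]; lia.
subst y'; have [|//|i' le_i' ti'] := growth_northwest gt tj (x := x) (y := y).
  exact: ltnW.
have eq_i : i' = i by apply: inj_t; rewrite ti' ti.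
rewrite ltn_neqAle -eq_i le_i' andbT; apply/eqP => /val_inj eij.
by move: ti'; rewrite eij tj => -[e]; lia.
Qed.

(** * Shapes *)

Lemma partition_nth_le (s : seq nat) (x : nat) :
  is_partition s -> (nth 0 s x.+1 <= nth 0 s x)%N.
Proof.
case/andP=> srt _; have [ltx|] := ltnP x.+1 (size s); last first.
  by move=> lex; rewrite (nth_default 0 lex).
have geq_trans : transitive geq by move=> a b c h1 h2; apply: leq_trans h2 h1.
by apply: (sorted_ltn_nth geq_trans 0%N srt); rewrite ?inE //; lia.
Qed.

Lemma tableau_growth (d n : nat) (la : {ffun 'I_d -> seq nat})
    (t : {ffun 'I_n -> node d}) :
    is_dpartition n la -> is_dtableau la t -> is_standard t -> is_growth t.
Proof.
case/andP=> /forallP laP _ [tla inj_t surj_t] [stdR stdC]; split.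
- by move=> i j; apply: inj_t; rewrite in_setE.
- move=> j x y k tj.
  have [] := tla j I; rewrite tj /node_row /node_col /node_comp /= => ltx lty.
  have /surj_t[i _ ti] : dnodes la (x, y, k).
    rewrite /dnodes /node_row /node_col /node_comp /=; split; first exact: ltnW.
    exact: leq_trans lty (partition_nth_le x (laP k)).
  by exists i => //; apply: stdC; rewrite tj ti /node_row.
- move=> j x y k tj.
  have [] := tla j I; rewrite tj /node_row /node_col /node_comp /= => ltx lty.
  have /surj_t[i _ ti] : dnodes la (x, y, k).
    rewrite /dnodes /node_row /node_col /node_comp /=.
    by split; last exact: ltnW.
  by exists i => //; apply: stdR; rewrite tj ti /node_col.
Qed.

Lemma mem_dnodes (d : nat) (la : {ffun 'I_d -> seq nat}) x y k :
  dnodes la (x, y, k) <-> (y < nth 0 (la k) x)%N.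
Proof.
rewrite /dnodes /node_row /node_col /node_comp /=; split=> [[]//|lty].
by split=> //; apply: contraLR lty; rewrite -!leqNgt => /(nth_default 0%N) ->.
Qed.

Lemma dnodes_inj (d n : nat) (la mu : {ffun 'I_d -> seq nat}) :
    is_dpartition n la -> is_dpartition n mu ->
  (forall u, dnodes la u <-> dnodes mu u) -> la = mu.
Proof.
case/andP=> /forallP laP _ /andP[/forallP muP _] eq_nodes.
apply/ffunP=> k.
have eq_nth x : nth 0 (la k) x = nth 0 (mu k) x.
  suff eq_lt y : (y < nth 0 (la k) x)%N = (y < nth 0 (mu k) x)%N.
    have := eq_lt (nth 0 (la k) x); have := eq_lt (nth 0 (mu k) x); lia.
  apply/idP/idP; first by move=> /mem_dnodes/eq_nodes/mem_dnodes.
  by move=> /mem_dnodes/eq_nodes/mem_dnodes.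
have size_nth (s : seq nat) x : is_partition s ->
    (x < size s)%N = (0 < nth 0 s x)%N.
  case/andP=> _ s0; have [ltx|lex] := ltnP; last by rewrite nth_default.
  by rewrite lt0n; apply/esym/(contraNneq _ s0) => <-; apply: mem_nth.
have eq_size : size (la k) = size (mu k).
  have h x : (x < size (la k))%N = (x < size (mu k))%N.
    by rewrite !size_nth // eq_nth.
  have := h (size (la k)); have := h (size (mu k)); lia.
exact: (@eq_from_nth _ 0%N).
Qed.

Definition dnodes_seq (d : nat) (la : {ffun 'I_d -> seq nat}) : seq (node d) :=
  [seq (xk.1, y, xk.2) | xk <- [seq (x, k) | k <- enum 'I_d,
                                             x <- iota 0 (size (la k))],
                         y <- iota 0 (nth 0 (la xk.2) xk.1)].

Lemma size_dnodes_seq (d : nat) (la : {ffun 'I_d -> seq nat}) :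
  size (dnodes_seq la) = (\sum_(k < d) sumn (la k))%N.
Proof.
rewrite size_allpairs_dep sumnE big_map big_allpairs_dep big_enum /=.
apply: eq_bigr => k _; rewrite sumnE [RHS](big_nth 0%N) /index_iota subn0.
by apply: eq_bigr => x _; rewrite size_iota.
Qed.

Lemma uniq_dnodes_seq (d : nat) (la : {ffun 'I_d -> seq nat}) :
  uniq (dnodes_seq la).
Proof.
apply: allpairs_uniq_dep => [||[[x k] y] [[x' k'] y'] _ _ /= [-> -> ->]] //.
  apply: allpairs_uniq_dep => [|k _|[k x] [k' x'] _ _ /= [-> ->]] //.
    exact: enum_uniq.
  exact: iota_uniq.
by move=> xk _; apply: iota_uniq.
Qed.

Lemma mem_dnodes_seq (d : nat) (la : {ffun 'I_d -> seq nat}) (u : node d) :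
  u \in dnodes_seq la <-> dnodes la u.
Proof.
case: u => [[x y] k]; split.
  case/allpairsPdep=> -[x' k'] [y' [_ yin [-> -> ->]]].
  by apply/mem_dnodes; rewrite mem_iota in yin.
move=> [ltx lty]; apply/allpairsPdep; exists (x, k), y.
split=> //; last by rewrite mem_iota.
by apply/allpairsPdep; exists k, x; rewrite mem_enum mem_iota.
Qed.

(** The size condition in [is_dpartition] compares two duplicate-free
    enumerations of the same nodes: the values of [t], and [dnodes_seq]. *)
Lemma sumn_shape (d n : nat) (la : {ffun 'I_d -> seq nat})
    (t : 'I_n -> node d) :
    injective t -> (forall u, dnodes la u <-> exists i, t i = u) ->
  (\sum_(k < d) sumn (la k))%N = n.
Proof.
move=> inj_t la_t; rewrite -size_dnodes_seq.
rewrite -[RHS]card_ord -(size_codom t); apply/perm_size/uniq_perm.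
- exact: uniq_dnodes_seq.
- by apply/injectiveP.
- move=> u; apply/idP/codomP => [/mem_dnodes_seq/la_t[i <-]|[i ->]].
    by exists i.
  by apply/mem_dnodes_seq/la_t; exists i.
Qed.

Definition row_length (d n : nat) (t : 'I_n -> node d) (k : 'I_d) (x : nat) :=
  (\max_(i < n | (node_comp (t i) == k) && (node_row (t i) == x))
     (node_col (t i)).+1)%N.

Definition row_count (d n : nat) (t : 'I_n -> node d) (k : 'I_d) :=
  (\max_(i < n | node_comp (t i) == k) (node_row (t i)).+1)%N.

Definition shape_of (d n : nat) (t : 'I_n -> node d) : {ffun 'I_d -> seq nat} :=
  [ffun k => mkseq (row_length t k) (row_count t k)].

Lemma bigmax_gtP (I : finType) (P : pred I) (F : I -> nat) (m : nat) :
  reflect (exists2 i, P i & (m < F i)%N) (m < \max_(i | P i) F i)%N.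
Proof.
apply: (iffP idP) => [|[i Pi ltm]]; last exact: (bigop.bigmax_sup i).
rewrite ltnNge => /bigmax_leqP nle; apply/exists_inP; apply: contraT.
by rewrite negb_exists_in => /forall_inP h; case: nle => i /h; rewrite -leqNgt.
Qed.

(** Down-closure turns the maxima in [row_length] and [row_count] into
    membership tests. *)
Lemma row_lengthP (d n : nat) (t : 'I_n -> node d) k x y : is_growth t ->
  (y < row_length t k x)%N <-> exists i, t i = (x, y, k).
Proof.
move=> gt; split=> [/bigmax_gtP[j]|[i ti]].
  case tj: (t j) => [[x' y'] k'].
  rewrite /node_comp /node_row /node_col /= => /andP[/eqP ek /eqP ex].
  subst k' x'; rewrite ltnS => ley.
  have [i _ ti] := growth_northwest gt tj (leqnn x) ley.
  by exists i.
by apply/bigmax_gtP; exists i; rewrite ti /node_comp /node_row /= ?eqxx.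
Qed.

Lemma row_countP (d n : nat) (t : 'I_n -> node d) k x : is_growth t ->
  (x < row_count t k)%N <-> exists i, t i = (x, 0%N, k).
Proof.
move=> gt; split=> [/bigmax_gtP[j]|[i ti]].
  case tj: (t j) => [[x' y'] k'].
  rewrite /node_comp /node_row /= => /eqP ek; subst k'; rewrite ltnS => lex.
  have [i _ ti] := growth_northwest gt tj lex (leq0n y').
  by exists i.
by apply/bigmax_gtP; exists i; rewrite ti /node_comp /node_row /= ?eqxx.
Qed.

Lemma dnodes_shape (d n : nat) (t : 'I_n -> node d) (u : node d) :
  is_growth t -> dnodes (shape_of t) u <-> exists i, t i = u.
Proof.
case: u => [[x y] k] gt.
rewrite /dnodes /node_row /node_col /node_comp /= ffunE size_mkseq.
split=> [[ltx]|[i ti]].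
  by rewrite nth_mkseq // => /(row_lengthP _ _ _ gt).
have ltx : (x < row_count t k)%N.
  apply/row_countP => //.
  have [i' _ ti'] := growth_northwest gt ti (leqnn x) (leq0n y).
  by exists i'.
by rewrite nth_mkseq //; split=> //; apply/row_lengthP => //; exists i.
Qed.

Lemma shape_dpartition (d n : nat) (t : 'I_n -> node d) :
  is_growth t -> is_dpartition n (shape_of t).
Proof.
move=> gt; have [inj_t _ _] := gt; apply/andP; split; last first.
  by apply/eqP/(sumn_shape inj_t) => u; apply: dnodes_shape.
apply/forallP=> k; rewrite ffunE; apply/andP; split.
  apply/(sortedP 0%N) => x; rewrite size_mkseq => ltx.
  rewrite !nth_mkseq ?(ltnW ltx) // /geq /= leqNgt; apply/negP.
  move=> /(row_lengthP _ _ _ gt)[j tj].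
  have [i _ ti] := growth_northwest gt tj (leqnSn x) (leqnn _).
  suff : (row_length t k x < row_length t k x)%N by rewrite ltnn.
  by apply/row_lengthP => //; exists i.
apply/negP=> /mapP[x]; rewrite mem_iota /= => /(row_countP _ _ gt) ex /esym.
by apply/eqP; rewrite -lt0n; apply/row_lengthP.
Qed.

Lemma shape_STab (d n : nat) (t : {ffun 'I_n -> node d}) :
  is_growth t -> STab d n (shape_of t, t).
Proof.
move=> gt; have [inj_t _ _] := gt; split=> /=.
- exact: shape_dpartition.
- split=> [i _|i j _ _|u /(dnodes_shape _ gt)[i ti]]; last by exists i.
    by apply/dnodes_shape => //; exists i.
  exact: inj_t.
- exact: growth_standard.
Qed.

(** * Content words *)

Definition letter (d : nat) (u : node d) : 'I_d * int :=
  (node_comp u, (node_col u)%:Z - (node_row u)%:Z)%R.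

Definition is_content_word (T : Type) (n : nat) (w : 'I_n -> T * int) : Prop :=
  (forall (j : 'I_n) k m, w j = (k, m) -> m != 0%R ->
     exists2 i : 'I_n, (i < j)%N &
       w i = (k, m + 1)%R \/ w i = (k, m - 1)%R) /\
  (forall (i j : 'I_n) k m, (i < j)%N -> w i = (k, m) -> w j = (k, m) ->
     exists i1 i2 : 'I_n, [/\ (i < i1 < j)%N, (i < i2 < j)%N,
       w i1 = (k, m - 1)%R & w i2 = (k, m + 1)%R]).

(** Two equal letters come from two nodes on one diagonal; the node
    above and the node to the left of the later one lie to the southeast of
    the earlier one, so both are inserted between the two. *)
Lemma growth_content_word (d n : nat) (t : 'I_n -> node d) :
  is_growth t -> is_content_word (fun i => letter (t i)).
Proof.
move=> gt; have [inj_t tU tL] := gt; split=> [j k m | i j k m lt_ij].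
  case tj: (t j) => [[x y] k'].
  rewrite /letter /node_comp /node_row /node_col /= => -[ek em] m0; subst k' m.
  case: x => [|x] in tj m0 *.
    case: y => [//|y] in tj m0 *; have [i lt_ij ti] := tL _ _ _ _ tj.
    by exists i => //; right; rewrite ti /=; congr (_, _); lia.
  have [i lt_ij ti] := tU _ _ _ _ tj.
  by exists i => //; left; rewrite ti /=; congr (_, _); lia.
case ti: (t i) => [[x y] k1]; case tj: (t j) => [[x' y'] k2].
rewrite /letter /node_comp /node_row /node_col /= => -[ek em] [ek' em'].
subst k1 k2 m.
have ltx : (x < x')%N.
  rewrite ltnNge; apply/negP => lex.
  have [||i' le_i' ti'] := growth_northwest gt ti (x := x') (y := y') => //.
    by lia.
  have e : i' = j by apply: inj_t; rewrite ti' tj.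
  by move: le_i'; rewrite e; lia.
case: x' => // x' in tj em' ltx *; case: y' => [|y'] in tj em' *; first by lia.
have [i2 lt2 ti2] := tU _ _ _ _ tj.
have [i1 lt1 ti1] := tL _ _ _ _ tj.
have later a xa ya : t a = (xa, ya, k) -> (x <= xa)%N -> (y <= ya)%N ->
    (x, y) != (xa, ya) -> (i < a)%N.
  move=> ta lex ley ne.
  have [i' le_i' ti'] := growth_northwest gt ta lex ley.
  have e : i' = i by apply: inj_t; rewrite ti' ti.
  rewrite ltn_neqAle -e le_i' andbT; apply: contra_neq ne => eia.
  by move: ti'; rewrite (val_inj eia) ta => -[-> ->].
exists i1, i2; split.
- by rewrite lt1 andbT; apply: (later _ _ _ ti1); rewrite ?xpair_eqE; lia.
- by rewrite lt2 andbT; apply: (later _ _ _ ti2); rewrite ?xpair_eqE; lia.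
- by rewrite ti1 /=; congr (_, _); lia.
- by rewrite ti2 /=; congr (_, _); lia.
Qed.

(** At the first index where two growths differ they put different nodes on the
    same diagonal; the one further southeast needs the other one to be
    present already, hence present in both growths, and the growth that inserts
    it now repeats it. *)
Lemma growth_letter_inj (d n : nat) (t t' : 'I_n -> node d) :
    is_growth t -> is_growth t' -> (forall i, letter (t i) = letter (t' i)) ->
  t =1 t'.
Proof.
move=> gt gt' eq_let i; have [m] := ubnP (val i).
elim: m => // m IHm in i *; rewrite ltnS => le_im.
have no_jump (s s' : 'I_n -> node d) : is_growth s -> is_growth s' ->
    (forall a : 'I_n, (a < i)%N -> s a = s' a) ->
    letter (s i) = letter (s' i) -> (node_row (s i) < node_row (s' i))%N ->
    False.
  move=> [inj_s _ _] gs' eq_lt; case si: (s i) => [[x y] k].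
  case si': (s' i) => [[x' y'] k'].
  rewrite /letter /node_comp /node_row /node_col /= => -[ek em] ltx; subst k'.
  have [||a le_a sa] := growth_northwest gs' si' (x := x) (y := y).
  - exact: ltnW.
  - by lia.
  have ne_ai : a != i by apply/eqP => e; move: sa; rewrite e si' => -[e']; lia.
  have lt_ai : (a < i)%N by rewrite ltn_neqAle le_a andbT.
  by case/eqP: ne_ai; apply: inj_s; rewrite eq_lt // sa si.
have eq_lt (a : 'I_n) : (a < i)%N -> t a = t' a.
  by move=> lt_ai; apply: IHm; apply: leq_trans lt_ai le_im.
have := no_jump t t' gt gt' eq_lt (eq_let i).
have := no_jump t' t gt' gt (fun a lt_a => esym (eq_lt a lt_a))
          (esym (eq_let i)).
have := eq_let i; case: (t i) => [[x y] k]; case: (t' i) => [[x' y'] k'].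
rewrite /letter /node_comp /node_row /node_col /= => -[ek em] /negP h1 /negP h2.
by rewrite ek; congr (_, _, _); lia.
Qed.

(** * From content words to growths *)

Definition earlier (T : eqType) (n : nat) (w : 'I_n -> T) (j : nat) (l : T) :=
  #|[set i : 'I_n | (i < j)%N && (w i == l)]|.

Lemma earlier_last (T : eqType) (n : nat) (w : 'I_n -> T) (j : nat) (l : T) :
    (0 < earlier w j l)%N ->
  exists i : 'I_n, [/\ (i < j)%N, w i = l & earlier w j l = (earlier w i l).+1].
Proof.
case/card_gt0P=> i0; rewrite inE => Pi0.
case: (@arg_maxnP _ i0 (fun i : 'I_n => (i < j)%N && (w i == l))
         (fun i => val i) Pi0).
move=> i /andP[lt_ij /eqP wi] max_i; exists i; split=> //.
rewrite /earlier (cardsD1 i) inE lt_ij wi eqxx add1n; congr _.+1.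
apply: eq_card => a; rewrite !inE; apply/idP/idP.
  case/and3P=> ne_ai lt_aj wa; rewrite wa andbT ltn_neqAle ne_ai.
  by apply: max_i; rewrite lt_aj.
by case/andP=> lt_ai ->; rewrite -val_eqE /=; lia.
Qed.

Lemma earlier_rank (T : eqType) (n : nat) (w : 'I_n -> T) (j r : nat) (l : T) :
    (r < earlier w j l)%N ->
  exists i : 'I_n, [/\ (i < j)%N, w i = l & earlier w i l = r].
Proof.
elim/ltn_ind: j => j IHj lt_r.
have [|i [lt_ij wi ei]] := @earlier_last _ _ w j l; first by lia.
move: lt_r; rewrite ei ltnS leq_eqVlt => /orP[/eqP-> | /(IHj _ lt_ij)].
  by exists i.
by case=> i' [lt_i' wi' ei']; exists i'; split=> //; apply: ltn_trans lt_ij.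
Qed.

Lemma earlier_ltn (T : eqType) (n : nat) (w : 'I_n -> T) (i b : 'I_n) (j : nat)
    (l : T) :
  (i <= b < j)%N -> w b = l -> (earlier w i l < earlier w j l)%N.
Proof.
case/andP=> le_ib lt_bj wb; apply: proper_card; apply/properP; split.
  apply/fintype.subsetP => a; rewrite !inE => /andP[lt_ai ->].
  by rewrite andbT; lia.
by exists b; rewrite !inE wb eqxx andbT //; lia.
Qed.

(** Some neighbouring letter occurs before index j. If it is the one farther
    from zero, then by induction a letter (k, m) occurs before it, and induction
    applies to that earlier occurrence of (k, m). The sign [e] points towards
    zero and treats both sides at once. *)
Lemma closer_to_zero (T : Type) (n : nat) (w : 'I_n -> T * int) (e : int)
    (j : 'I_n) k m :
    is_content_word w -> e = 1%R \/ e = (- 1)%R -> w j = (k, m) ->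
    (m * e < 0)%R ->
  exists2 i : 'I_n, (i < j)%N & w i = (k, m + e)%R.
Proof.
case=> wN _ eE; have [b] := ubnP (val j).
elim: b => // b IHb in j m *; rewrite ltnS => le_jb wj lt_m.
have m0 : m != 0%R by apply: contraTneq lt_m => ->; rewrite mul0r ltxx.
have [i lt_ij wi] := wN _ _ _ wj m0.
have {wi} [wi|wi] : w i = (k, m + e)%R \/ w i = (k, m - e)%R.
  by case: eE wi => -> //; rewrite opprK; tauto.
  by exists i.
have [||i' lt_i'i] := IHb i (m - e)%R _ wi.
- exact: leq_trans lt_ij le_jb.
- by case: eE lt_m => -> ; lia.
rewrite subrK => wi'.
have lt_i'j := ltn_trans lt_i'i lt_ij.
have [||i2 lt_i2 wi2] := IHb i' m _ wi' => //; first exact: leq_trans le_jb.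
by exists i2 => //; apply: ltn_trans lt_i'j.
Qed.

(** Between two consecutive occurrences of a letter each neighbouring letter
    occurs; for the neighbour closer to zero there is in addition an occurrence
    before the first one, by [closer_to_zero]. *)
Lemma earlier_neighbour (T : eqType) (n : nat) (w : 'I_n -> T * int) (e : int)
    (j : 'I_n) k m :
    is_content_word w -> e = 1%R \/ e = (- 1)%R -> w j = (k, m) ->
  (earlier w j (k, m) + (m * e < 0)%R <= earlier w j (k, m + e)%R)%N.
Proof.
move=> cw eE; have [_ wB] := cw; have [b] := ubnP (val j).
elim: b => // b IHb in j *; rewrite ltnS => le_jb wj.
have [e0|] := posnP (earlier w j (k, m)).
  rewrite e0; case: (boolP (m * e < 0)%R) => // lt_m.
  have [i lt_ij wi] := closer_to_zero cw eE wj lt_m.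
  by apply/card_gt0P; exists i; rewrite inE lt_ij wi eqxx.
case/earlier_last=> i [lt_ij wi ->].
have := IHb i (leq_trans lt_ij le_jb) wi.
have [i1 [i2 [lt1 lt2 wi1 wi2]]] := wB _ _ _ _ lt_ij wi wj.
suff : (earlier w i (k, m + e)%R < earlier w j (k, m + e)%R)%N by lia.
have ltW a : (i < a < j)%N -> (i <= a < j)%N by lia.
case: eE => ->; first exact: earlier_ltn (ltW _ lt2) wi2.
exact: earlier_ltn (ltW _ lt1) wi1.
Qed.

(** On the diagonal of content [l.2], the position [p] from the boundary is the
    smaller one of the two coordinates. *)
Definition diag_node (d : nat) (l : 'I_d * int) (p : nat) : node d :=
  if (l.2 < 0)%R then (p + `|l.2|, p, l.1)%N else (p, p + `|l.2|, l.1)%N.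

Lemma letter_diag_node (d : nat) (l : 'I_d * int) (p : nat) :
  letter (diag_node l p) = l.
Proof.
case: l => k m; rewrite /diag_node /letter /=.
by case: ltrP => hm; rewrite /node_comp /node_row /node_col /=;
  congr (_, _); lia.
Qed.

Lemma diag_node_inj (d : nat) (l : 'I_d * int) : injective (diag_node l).
Proof. by move=> p p'; rewrite /diag_node; case: ifP => _ []; lia. Qed.

(** Diagonals are filled from the boundary inwards, so the position is the number
    of nodes already on the diagonal. *)
Definition growth_of (d n : nat) (w : 'I_n -> 'I_d * int) : 'I_n -> node d :=
  fun j => diag_node (w j) (earlier w j (w j)).

Lemma growth_of_inj (d n : nat) (w : 'I_n -> 'I_d * int) :
  injective (growth_of w).
Proof.
move=> i j eq_ij; have := congr1 (@letter d) eq_ij.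
rewrite !letter_diag_node => eq_w.
move: eq_ij; rewrite /growth_of eq_w => eq_n; have eq_p := diag_node_inj eq_n.
have no_lt (a b : 'I_n) : (a < b)%N -> w a = w b ->
    earlier w a (w b) = earlier w b (w b) -> False.
  move=> lt_ab wab eq_ab; have := @earlier_ltn _ _ w a a b _ _ wab.
  by rewrite eq_ab leqnn lt_ab ltnn => /(_ isT).
apply: val_inj; case: (ltngtP i j) => // lt; exfalso.
  exact: no_lt lt eq_w eq_p.
by apply: no_lt lt (esym eq_w) _; rewrite eq_w eq_p.
Qed.

(** The neighbour of a node lies on an adjacent diagonal, at the same position
    when that diagonal is closer to the main one, and one position before
    otherwise; [earlier_neighbour] gives enough occurrences in both cases. *)
Lemma growth_of_growth (d n : nat) (w : 'I_n -> 'I_d * int) :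
  is_content_word w -> is_growth (growth_of w).
Proof.
move=> cw.
have find (e : int) (j : 'I_n) k m (r : nat) :
    e = 1%R \/ e = (- 1)%R -> w j = (k, m) ->
    (r < earlier w j (k, m) + (m * e < 0)%R)%N ->
    exists2 i : 'I_n, (i < j)%N & growth_of w i = diag_node (k, m + e)%R r.
  move=> eE wj lt_r.
  have [i [lt_ij wi ei]] :=
    earlier_rank (leq_trans lt_r (earlier_neighbour cw eE wj)).
  by exists i; rewrite // /growth_of wi ei.
split; first exact: growth_of_inj.
  move=> j x y k; rewrite {1}/growth_of; case wj: (w j) => [k' m].
  have fnd r := find 1%R j k' m r (or_introl erefl) wj.
  rewrite /diag_node /=; move: (earlier _ _ _) => p in fnd *.
  case: ltrP => hm [ex ey ek]; subst k'.
    have [|i lt_ij gi] := fnd p; first by lia.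
    exists i; rewrite // gi /diag_node /=.
    by case: ltrP => hm'; congr (_, _, _); lia.
  have [|i lt_ij gi] := fnd p.-1; first by lia.
  exists i; rewrite // gi /diag_node /=.
  by case: ltrP => hm'; congr (_, _, _); lia.
move=> j x y k; rewrite {1}/growth_of; case wj: (w j) => [k' m].
have fnd r := find (- 1)%R j k' m r (or_intror erefl) wj.
rewrite /diag_node /=; move: (earlier _ _ _) => p in fnd *.
case: (ltrP 0%R m) => hm0; case: ltrP => hm [ex ey ek]; subst k'; try lia.
  have [|i lt_ij gi] := fnd p; first by lia.
  exists i; rewrite // gi /diag_node /=.
  by case: ltrP => hm'; congr (_, _, _); lia.
all: have [|i lt_ij gi] := fnd p.-1; first by lia.
all: exists i; rewrite // gi /diag_node /=.
all: by case: ltrP => hm'; congr (_, _, _); lia.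
Qed.

(** * Roots of unity and powers of the indeterminate *)

(** In characteristic 0 the polynomial X^d - 1 is separable, so it has d
    distinct roots in an algebraically closed field. They remain all of its roots
    in an extension, where the same factorization holds. *)
Lemma roots_of_unity (F : closedFieldType) (L : fieldType)
    (phi : {rmorphism F -> L}) (d : nat) :
    (d%:R != 0 :> F)%R ->
  exists z : 'I_d -> L,
    injective z /\ (forall a, (a ^+ d = 1)%R <-> exists k, a = z k).
Proof.
move=> d0; have d_gt0 : (0 < d)%N by case: d d0; rewrite ?eqxx.
have [rs] := closed_field_poly_normal ('X^d - 1 : {poly F})%R.
rewrite lead_coefXnsubC // scale1r => eq_rs.
have uniq_rs : uniq rs.
  by rewrite -separable_prod_XsubC -eq_rs separable_Xn_sub_1.
have size_rs : size rs = d.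
  by apply: succn_inj; rewrite -(size_prod_XsubC rs id) -eq_rs size_XnsubC.
exists (fun k => phi (rs`_k)%R); split=> [k k' /fmorph_inj/eqP|a].
  by rewrite nth_uniq ?size_rs // => /eqP/val_inj.
have memE : (a ^+ d = 1)%R <-> a \in map phi rs.
  have := congr1 (map_poly phi) eq_rs; rewrite map_prod_XsubC.
  rewrite rmorphB /= map_polyXn rmorph1 => eq_L.
  rewrite -root_prod_XsubC big_map -eq_L rootE !hornerE subr_eq0.
  by split=> [->|/eqP].
rewrite memE; split=> [/(nthP 0%R)[k]|[k ->]]; last first.
  by apply: map_f; rewrite mem_nth ?size_rs.
rewrite size_map size_rs => ltk <-; exists (Ordinal ltk).
by rewrite (nth_map 0%R) // size_rs.
Qed.

Lemma roots_of_unity_Cq (R : realType) (d : nat) : (1 <= d)%N ->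
  exists z : 'I_d -> Cq R,
    injective z /\ (forall a, (a ^+ d = 1)%R <-> exists k, a = z k).
Proof.
move=> d_gt0; have d0 : (d%:R != 0 :> R[i])%R by rewrite pnatr_eq0 -lt0n.
exact: (@roots_of_unity R[i] (Cq R)
          ((@tofrac {poly R[i]} \o polyC)%FUN : {rmorphism R[i] -> Cq R}) d d0).
Qed.

Lemma q_indet_neq0 (R : realType) : (q_indet R != 0)%R.
Proof. by rewrite /q_indet tofrac_eq0 polyX_eq0. Qed.

Lemma q_indet_expz_inj (R : realType) :
  injective (fun m : int => q_indet R ^ m)%R.
Proof.
move=> m m' /= eq_q.
have q0 := q_indet_neq0 R.
have : (q_indet R ^ (m - m') = 1)%R.
  by rewrite expfzDr // eq_q -expfzDr // subrr.
have expn_eq1 (p : nat) : (q_indet R ^+ p = 1)%R -> p = 0%N.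
  move=> /eqP; rewrite /q_indet -rmorphXn -(rmorph1 (@tofrac {poly R[i]})).
  rewrite tofrac_eq.
  move=> /eqP/(congr1 (fun p : {poly R[i]} => size p)).
  by rewrite size_polyXn size_poly1 => -[].
case E: (m - m')%R => [p|p] /=; rewrite /exprz.
  by move/expn_eq1; lia.
by move=> /(congr1 (fun x => x^-1)%R); rewrite invrK invr1 => /expn_eq1.
Qed.

Lemma q_power_inj (R : realType) :
  injective (fun m : int => q_indet R ^ (m * 2))%R.
Proof. by move=> m m' /(@q_indet_expz_inj R); lia. Qed.

Lemma q_powerB (R : realType) (m : int) :
  (q_indet R ^ ((m - 1) * 2) = q_indet R ^ (m * 2) * q_indet R ^- 2)%R.
Proof.
by rewrite mulrBl expfzDr ?q_indet_neq0 // mul1r -exprnN.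
Qed.

Lemma q_powerD (R : realType) (m : int) :
  (q_indet R ^ ((m + 1) * 2) = q_indet R ^ (m * 2) * q_indet R ^+ 2)%R.
Proof. by rewrite mulrDl expfzDr ?q_indet_neq0 // mul1r -exprnP. Qed.

(** * Content arrays *)

Definition array (R : realType) (d n : nat) (z : 'I_d -> Cq R)
    (w : 'I_n -> 'I_d * int) : 'M[Cq R]_(2, n) :=
  (\matrix_(r, i) if r == 0 then z (w i).1 else q_indet R ^ ((w i).2 * 2))%R.

Lemma array_inj (R : realType) (d n : nat) (z : 'I_d -> Cq R)
    (w w' : 'I_n -> 'I_d * int) :
  injective z -> array z w = array z w' -> w =1 w'.
Proof.
move=> inj_z eq_w i.
have := congr1 (fun M : 'M_(2, n) => M 0%R i) eq_w; rewrite !mxE /=.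
move=> /inj_z eq1.
have := congr1 (fun M : 'M_(2, n) => M 1%R i) eq_w; rewrite !mxE /=.
move=> /q_power_inj eq2.
by rewrite [LHS]surjective_pairing eq1 eq2 -surjective_pairing.
Qed.

(** The entry c_1 is 1 because nothing precedes the first letter, and equal
    columns are at distance at least 3 because the two neighbouring letters
    between them are different. *)
Lemma array_Cont (R : realType) (d n : nat) (z : 'I_d -> Cq R)
    (w : 'I_n -> 'I_d * int) :
    injective z -> (forall k, z k ^+ d = 1)%R ->
  is_content_word w <-> Cont R d n (array z w).
Proof.
move=> inj_z zd.
have aE i : array z w 0%R i = z (w i).1 by rewrite mxE.
have cE i : (array z w 1 i = q_indet R ^ ((w i).2 * 2))%R by rewrite mxE.
have cB i j : array z w 1%R i = (array z w 1 j * q_indet R ^- 2)%R ->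
    (w i).2 = ((w j).2 - 1)%R.
  by rewrite !cE -q_powerB => /q_power_inj.
have cD i j : array z w 1%R i = (array z w 1 j * q_indet R ^+ 2)%R ->
    (w i).2 = ((w j).2 + 1)%R.
  by rewrite !cE -q_powerD => /q_power_inj.
have c1 i : array z w 1%R i = 1%R <-> (w i).2 = 0%R.
  by rewrite cE; split=> [e|->]; first by apply: (@q_power_inj R); rewrite e.
split=> [[wN wB]|[[c0 _] CN CB]].
  split.
  - split=> [i i0|i]; last by rewrite aE.
    apply/c1; case wi: (w i) => [k m] /=; apply/eqP; apply: contraT => m0.
    by have [i' ] := wN _ _ _ wi m0; rewrite i0.
  - move=> j _ cj; case wj: (w j) => [k m].
    have m0 : m != 0%R by apply: contra_not_neq cj => m0; apply/c1; rewrite wj.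
    have [i lt_ij wi] := wN _ _ _ wj m0; exists i; split=> //.
      by rewrite !aE wj; case: wi => ->.
    by rewrite !cE wj; case: wi => -> /=;
      [right; rewrite q_powerD | left; rewrite q_powerB].
  - move=> j k lt_jk; rewrite !aE => /inj_z e1; rewrite !cE => /q_power_inj e2.
    case wj: (w j) => [c m]; have wk : w k = (c, m).
      by rewrite [LHS]surjective_pairing -e1 -e2 wj.
    have [i1 [i2 [lt1 lt2 w1 w2]]] := wB _ _ _ _ lt_jk wj wk.
    have ne12 : i1 <> i2 :> nat.
      by move=> /val_inj e; move: w1; rewrite e w2 => -[]; lia.
    split; first by lia.
    exists i1, i2; split=> //.
    + by rewrite !aE w1 w2.
    + by rewrite cE w1 q_powerB.
    + by rewrite cE w2 q_powerD.
split=> [j k m wj m0|i j k m lt_ij wi wj].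
  have cj : array z w 1%R j <> 1%R by move=> /c1; rewrite wj /=; apply/eqP.
  have j0 : (0 < j)%N by rewrite lt0n; apply/eqP => /c0.
  have [i [lt_ij]] := CN j j0 cj; rewrite !aE => /inj_z e1 e2; exists i => //.
  by case: e2 => [/cB|/cD] e2; [right | left];
    rewrite [LHS]surjective_pairing e1 e2 wj.
have [||_ [i1 [i2 [lt1 lt2 [a1 a2] e1 e2]]]] := CB i j lt_ij.
- by rewrite !aE wi wj.
- by rewrite !cE wi wj.
move: a1 a2 (cB _ _ e1) (cD _ _ e2); rewrite !aE wi /=.
move=> /inj_z a1 /inj_z a2 {}e1 {}e2.
exists i1, i2; split=> //.
  by rewrite [LHS]surjective_pairing a1 e1.
by rewrite [LHS]surjective_pairing a2 e2.
Qed.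

(** The second row consists of even powers of q: each entry other than 1 is q^2
    or q^-2 times an earlier one. *)
Lemma Cont_array (R : realType) (d n : nat) (z : 'I_d -> Cq R)
    (M : 'M[Cq R]_(2, n)) :
    (forall a, (a ^+ d = 1)%R -> exists k, a = z k) -> Cont R d n M ->
  exists w, M = array z w.
Proof.
move=> zP [[c0 ad] CN _].
have [k kP] : exists k, forall i, M 0%R i = z (k i).
  apply: (@fin_all_exists _ _ (fun i k => M 0%R i = z k)) => i.
  exact/zP/ad.
have [m mP] : exists m, forall i, M 1%R i = (q_indet R ^ (m i * 2))%R.
  apply: (@fin_all_exists _ _
            (fun i m => M 1%R i = (q_indet R ^ (m * 2))%R)) => j.
  have [b] := ubnP (val j).
  elim: b => // b IHb in j *; rewrite ltnS => le_jb.
  have [cj|/eqP cj] := eqVneq (M 1%R j) 1%R; first by exists 0%R; rewrite cj.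
  have j0 : (0 < j)%N by rewrite lt0n; apply/eqP => /c0.
  have [i [lt_ij _ ci]] := CN j j0 cj.
  have [mi ciE] := IHb i (leq_trans lt_ij le_jb).
  have q20 : (q_indet R ^+ 2 != 0)%R by rewrite expf_neq0 ?q_indet_neq0.
  case: ci => ci.
    by exists (mi + 1)%R; rewrite q_powerD -ciE ci divfK.
  by exists (mi - 1)%R; rewrite q_powerB -ciE ci mulfK.
exists (fun i => (k i, m i)); apply/matrixP => r i; rewrite mxE.
case: r => [[|[|//]] ltr] /=.
  by rewrite -kP; congr (M _ _); apply: val_inj.
by rewrite -mP; congr (M _ _); apply: val_inj.
Qed.

Theorem proposition4 (R : realType) (d n : nat) (hd : (1 <= d)%N)
    (hn : (1 <= n)%N) :
  exists f : {ffun 'I_d -> seq nat} * {ffun 'I_n -> node d} -> 'M[Cq R]_(2, n),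
    set_bij (STab d n) (Cont R d n) f.
Proof.
have [z [inj_z zP]] := roots_of_unity_Cq R hd.
have zd k : (z k ^+ d = 1)%R by apply/zP; exists k.
have STab_growth T : STab d n T -> is_growth T.2.
  by case; apply: tableau_growth.
exists (fun T : _ * {ffun 'I_n -> node d} => array z (fun i => letter (T.2 i))).
split.
- move=> T /STab_growth gT.
  by apply/(array_Cont _ inj_z zd)/growth_content_word.
- move=> [la t] [mu s]; rewrite !in_setE => Tla Tmu /=.
  move=> /(array_inj inj_z) eq_let.
  have eq_ts : t = s.
    apply/ffunP/growth_letter_inj => //.
      exact: STab_growth Tla.
    exact: STab_growth Tmu.
  move: Tla Tmu; rewrite eq_ts.
  move=> -[/= laP [la_s _ s_la] _] [/= muP [mu_s _ s_mu] _].
  congr (_, _); apply: (dnodes_inj laP muP) => u.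
  by split=> [/s_la|/s_mu] [i _ <-]; [apply: mu_s | apply: la_s].
- move=> M CM; have [w Mw] := Cont_array (fun a => (zP a).1) CM.
  have cw : is_content_word w by apply/(array_Cont _ inj_z zd); rewrite -Mw.
  have gw := growth_of_growth cw.
  pose t := [ffun i => growth_of w i].
  have gt : is_growth t.
    case: gw => [inj_w wU wL].
    split=> [i j|j x y k|j x y k]; rewrite !ffunE; first exact: inj_w.
      by move/wU => [i lt_ij wi]; exists i; rewrite ?ffunE.
    by move/wL => [i lt_ij wi]; exists i; rewrite ?ffunE.
  exists (shape_of t, t); first exact: shape_STab.
  have letE i : letter (t i) = w i by rewrite ffunE letter_diag_node.
  by rewrite Mw; apply/matrixP => r i; rewrite !mxE -letE.
Qed.
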